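(* There is an infinite tournament $T\in\mathfrak{Out}_3\setminus\mathfrak{Out}_2$.
   Context: A tournament is a digraph $G=(V,E)$ such that for any two distinct $x,y\in V$ exactly one of $(x,y),(y,x)$ is in $E$. A set $A\subseteq V$ is independent if there is no edge (in either direction) between two distinct elements of $A$. For $n\in\mathbb N$, a digraph $G=(V,E)$ is in $\mathfrak{Out}_n$ iff there is an independent set $A\subseteq V$ such that for each $v\in V$ there is a directed path of length at most $n$ (length $0$ allowed) from some point of $A$ to $v$. *)

(* Defs.v *)
From mathcomp Require Import all_boot.
From mathcomp Require Import boolp classical_sets functions cardinality.

Set Implicit Arguments.
Unset Strict Implicit.
Unset Printing Implicit Defensive.

Local Open Scope classical_set_scope.

(* A digraph (V, E) is given by a vertex type V and an edge relation E, where
   E x y means (x, y) \in E. V may be infinite; finiteness is never assumed. *)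

(* (+) is exclusive or: exactly one of the two edges is present. *)
Definition tournament (V : eqType) (E : rel V) : Prop :=
  forall x y : V, x != y -> E x y (+) E y x.

Definition independent (V : eqType) (E : rel V) (A : set V) : Prop :=
  forall x y : V, A x -> A y -> x != y -> ~~ (E x y || E y x).

(* The path a :: p has distinct vertices and its length is size p, the number
   of its edges; p = [::] is the path of length 0. *)
Definition dipath_le (V : eqType) (E : rel V) (n : nat) (a v : V) : Prop :=
  exists p : seq V,
    [/\ path E a p, uniq (a :: p), last a p = v & size p <= n].

Definition Out (n : nat) (V : eqType) (E : rel V) : Prop :=
  exists A : set V, independent E A /\
    forall v : V, exists2 a : V, A a & dipath_le E n a v.

(* Main.v *)
(* A vertex [a] fails to reach everything in two steps as soon as some [w]
   dominates [a] together with all out-neighbours of [a].  Take three copies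
   [c], [x], [y] of the naturals.  Within a copy, and from [c] to [y], larger
   indices dominate strictly smaller ones; [x_i -> y_j] and [y_i -> c_j] also
   hold for equal indices (so [c_i -> y_j] and [y_i -> x_j] iff [j < i]);
   finally [c_i -> x_j] always.  Then [c_i] is dominated in the above sense by
   [c_i.+1], [x_i] by [c_i.+1] and [y_i] by [y_i.+1], while
   [c_0 -> x_j -> y_j -> c_j] reaches every vertex in three steps. *)
Require Import Defs.
From mathcomp Require Import all_boot.
From mathcomp Require Import boolp classical_sets functions cardinality.

Local Open Scope classical_set_scope.

Lemma independent_tournament_eq (V : eqType) (E : rel V) (A : set V) (x y : V) :
  tournament E -> independent E A -> A x -> A y -> x = y.
Proof.
move=> tE iA Ax Ay; apply/eqP/negPn/negP => xy.
by move: (tE x y xy) (iA x y Ax Ay xy); case: (E x y); case: (E y x).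
Qed.

(** A path of length 0 would be a loop at [a]; one of length 1 or 2 would end with the reverse of an
    edge leaving [w]. Asymmetry forbids both. *)
Lemma dominated_not_dipath_le2 (V : eqType) (E : rel V) (a w : V) :
  (forall x y, E x y -> ~~ E y x) -> E w a -> (forall b, E a b -> E w b) ->
  ~ dipath_le E 2 a w.
Proof.
move=> asymE wa aw [[|b [|c [|d p]]]] [] //=.
- by move=> _ _ aE; rewrite -aE in wa; move: (asymE a a wa); rewrite wa.
- by rewrite andbT => ab _ bE; move: (asymE w a wa); rewrite -bE ab.
- rewrite andbT => /andP[ab bc] _ cE _.
  by move: (asymE w b (aw b ab)); rewrite -cE bc.
Qed.

(** An independent set has at most one point [a] here, and the [w] dominating it stays out of reach.
    Asymmetry is a separate hypothesis because [tournament] says nothing about loops. *)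
Lemma not_Out2 (V : eqType) (E : rel V) (v0 : V) :
  tournament E -> (forall x y, E x y -> ~~ E y x) ->
  (forall a, exists2 w, E w a & forall b, E a b -> E w b) -> ~ Out 2 E.
Proof.
move=> tE asymE dom [A [iA reachA]].
have [a Aa _] := reachA v0.
have [w wa aw] := dom a.
have [a' Aa'] := reachA w.
rewrite (independent_tournament_eq _ _ _ _ _ tE iA Aa' Aa).
exact: dominated_not_dipath_le2.
Qed.

(* [Some true], [None] and [Some false] tag the copies [c], [x] and [y]. *)
Definition layered_rel : rel (option bool * nat) := fun u v =>
  match u.1, v.1 with
  | Some true, None => true
  | None, Some true => false
  | None, Some false | Some false, Some true => v.2 <= u.2
  | _, _ => v.2 < u.2
  end.

Lemma layered_rel_asym u v : layered_rel u v -> ~~ layered_rel v u.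
Proof.
by case: u v => [[[]|] i] [[[]|] j]; rewrite /layered_rel //= -?leqNgt -?ltnNge //;
  apply: ltnW.
Qed.

Lemma layered_rel_tournament : tournament layered_rel.
Proof.
case=> [[[]|] i] [[[]|] j] //; rewrite xpair_eqE /layered_rel /=;
  by case: ltngtP.
Qed.

Lemma layered_rel_dominated u :
  exists2 w, layered_rel w u & forall v, layered_rel u v -> layered_rel w v.
Proof.
case: u => [[[]|] i].
- exists (Some true, i.+1) => [|[[[]|] j]]; rewrite /layered_rel //=; exact: leqW.
- exists (Some false, i.+1) => [|[[[]|] j]]; rewrite /layered_rel //=; exact: leqW.
- by exists (Some true, i.+1) => [|[[[]|] j]].
Qed.

Lemma layered_rel_Out3 : Out 3 layered_rel.
Proof.
exists [set (Some true, 0)]; split => [x y -> ->|v]; first by rewrite eqxx.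
exists (Some true, 0) => //; case: v => [[[]|] j].
(* For index 0 the three-step route would return to its start and violate [uniq]. *)
- case: j => [|j]; first by exists [::].
  exists [:: (None, j.+1); (Some false, j.+1); (Some true, j.+1)].
  by split=> //; rewrite /layered_rel /= !leqnn.
- exists [:: (None, j); (Some false, j)].
  by split=> //; rewrite /layered_rel /= !leqnn.
- by exists [:: (None, j)].
Qed.

Theorem theorem4p3 :
  exists (V : eqType) (E : rel V),
    [/\ infinite_set [set: V], tournament E, Out 3 E & ~ Out 2 E].
Proof.
exists (option bool * nat)%type, layered_rel; split.
- move=> /(finite_image snd); apply: (sub_infinite_set _ infinite_nat) => n _.
  by exists (None, n).
- exact: layered_rel_tournament.
- exact: layered_rel_Out3.
- apply: (not_Out2 _ _ (None, 0)); first exact: layered_rel_tournament.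
  + exact: layered_rel_asym.
  + exact: layered_rel_dominated.
Qed.
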